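(* Let $Q$ be a pentaform. If $Q$ satisfies perfect-recall, then $Q$ satisfies no-absentmindedness.
   Context: A quintuple $\langle i,j,w,a,y\rangle$ has arbitrary objects as components, called player, situation, decision node, action, successor node. Decision nodes and successor nodes are both nodes (the same object may occur as both). A quintuple set $Q$ is a (possibly infinite) set of quintuples. For a string of letters from $I,J,W,A,Y$, $\pi_{\cdots}(Q)$ is the projection of $Q$ onto those coordinates, in the order listed, e.g. $\pi_{JI}(Q)=\{\langle j,i\rangle\mid \exists w,a,y:\ \langle i,j,w,a,y\rangle\in Q\}$. Write $J=\pi_J(Q)$, $W=\pi_W(Q)$, $Y=\pi_Y(Q)$. For $j\in J$, the slice is $Q_j=\{\langle i_*,j_*,w_*,a_*,y_*\rangle\in Q\mid j_*=j\}$. A function is a set $f$ of couples such that $\langle x,z\rangle,\langle x,z'\rangle\in f$ implies $z=z'$. A pentaform is a quintuple set $Q$ such that: [Pij] $\pi_{JI}(Q)$ is a function; [Pjw] $\pi_{WJ}(Q)$ is a function; [Pwa] for all $j\in J$, $\pi_{WA}(Q_j)$ is a Cartesian product; [Pway] $\{\langle\langle w,a\rangle,y\rangle\mid\langle w,a,y\rangle\in\pi_{WAY}(Q)\}$ is a function; [Pwy] $\pi_{YW}(Q)$ is a function, denoted $p$; [Pay] $\pi_{YA}(Q)$ is a function; [Py] for every $y\in Y$ there is $m\ge1$ with $p^m(y)\notin Y$ (iterates of $p$ from $y$ eventually leave $Y$); [Pr] $W\smallsetminus Y$ is a singleton. For a pentaform $Q$, define $x\preccurlyeq y$ on $W\cup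 Y$ iff there is a finite sequence $\langle x_0,\dots,x_m\rangle$ ($m\ge0$) in $W\cup Y$ with $x_0=x$, $x_m=y$ and $\langle x_\ell,x_{\ell+1}\rangle\in\pi_{WY}(Q)$ for all $\ell<m$; and $x\prec y$ iff $x\preccurlyeq y$ and $x\ne y$. For each $y\in Y$, let $a_y=\pi_{YA}(Q)(y)$, $j_y=\pi_{WJ}(Q)(p(y))$, and $i_y=\pi_{JI}(Q)(j_y)$. $Q$ satisfies perfect-recall iff for all $y_0,y_1,y_2\in Y$, the conditions $j_{y_1}=j_{y_2}$, $y_0\prec y_1$, and $i_{y_0}=i_{y_1}$ imply the existence of $y_{00}\in Y$ such that $y_{00}\prec y_2$ and $\langle j_{y_{00}},a_{y_{00}}\rangle=\langle j_{y_0},a_{y_0}\rangle$. $Q$ satisfies no-absentmindedness iff there do not exist $y_1,y_2\in Y$ with $y_1\prec y_2$ and $j_{y_1}=j_{y_2}$. *)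

(* Defs.v *)
From mathcomp Require Import all_boot.
From mathcomp Require Import boolp classical_sets.

Set Implicit Arguments.
Unset Strict Implicit.
Unset Printing Implicit Defensive.

Local Open Scope classical_set_scope.

(* Set-theoretic functions: a function is a set of couples, so it is in general
   partial as a map between types; [app f x] is its value at [x], with [None]
   standing for "x is not in the domain of f". *)

Definition is_function (T U : Type) (f : set (T * U)) : Prop :=
  forall x z z', f (x, z) -> f (x, z') -> z = z'.

Definition app (T U : Type) (f : set (T * U)) (x : T) : option U :=
  if pselect (exists z, f (x, z)) is left e then Some (projT1 (cid e)) else None.

Definition is_cartesian_product (T U : Type) (S : set (T * U)) : Prop :=
  exists (B : set T) (C : set U), S = B `*` C.

(* The two node components share one type, since the same object may be both a
   decision node and a successor node. The other component types are unrelated: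
   no condition compares components of different kinds. *)
Record quintuple (I J N A : Type) := Quintuple {
  player : I;
  situation : J;
  decision : N;
  action : A;
  successor : N
}.

Section Pentaform.
Variables I J N A : Type.
Implicit Types Q : set (quintuple I J N A).

Definition pJ Q : set J := [set situation q | q in Q].
Definition pW Q : set N := [set decision q | q in Q].
Definition pY Q : set N := [set successor q | q in Q].
Definition pJI Q : set (J * I) := [set (situation q, player q) | q in Q].
Definition pWJ Q : set (N * J) := [set (decision q, situation q) | q in Q].
Definition pWA Q : set (N * A) := [set (decision q, action q) | q in Q].
Definition pWY Q : set (N * N) := [set (decision q, successor q) | q in Q].
Definition pYW Q : set (N * N) := [set (successor q, decision q) | q in Q].
Definition pYA Q : set (N * A) := [set (successor q, action q) | q in Q].
(* Triples are left-nested pairs, so this is also the set of couples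
   <<w,a>,y> obtained from the triples <w,a,y>. *)
Definition pWAY Q : set (N * A * N) :=
  [set (decision q, action q, successor q) | q in Q].

Definition slice Q (j : J) : set (quintuple I J N A) :=
  [set q | Q q /\ situation q = j].

Definition pred_iter Q (m : nat) (y : N) : option N :=
  iter m (obind (app (pYW Q))) (Some y).

Record pentaform Q : Prop := {
  Pij : is_function (pJI Q);
  Pjw : is_function (pWJ Q);
  Pwa : forall j, pJ Q j -> is_cartesian_product (pWA (slice Q j));
  Pway : is_function (pWAY Q);
  Pwy : is_function (pYW Q);
  Pay : is_function (pYA Q);
  Py : forall y, pY Q y ->
         exists2 m : nat, 1 <= m &
           exists2 z, pred_iter Q m y = Some z & ~ pY Q z;
  Pr : exists r, pW Q `\` pY Q = [set r]
}.

(* Only the terms s 0, ..., s m of s are used. *)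
Definition preceq Q (x y : N) : Prop :=
  exists (m : nat) (s : nat -> N),
    [/\ forall l, l <= m -> (pW Q `|` pY Q) (s l),
        s 0 = x,
        s m = y &
        forall l, l < m -> pWY Q (s l, s l.+1)].

Definition prec Q (x y : N) : Prop := preceq Q x y /\ x <> y.

(* When Q is a pentaform and y is in Y, these three values are never None. *)
Definition action_of Q (y : N) : option A := app (pYA Q) y.
Definition situation_of Q (y : N) : option J :=
  obind (app (pWJ Q)) (app (pYW Q) y).
Definition player_of Q (y : N) : option I :=
  obind (app (pJI Q)) (situation_of Q y).

Definition perfect_recall Q : Prop :=
  forall y0 y1 y2, pY Q y0 -> pY Q y1 -> pY Q y2 ->
    situation_of Q y1 = situation_of Q y2 ->
    prec Q y0 y1 ->
    player_of Q y0 = player_of Q y1 ->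
    exists y00, [/\ pY Q y00, prec Q y00 y2 &
      (situation_of Q y00, action_of Q y00)
      = (situation_of Q y0, action_of Q y0)].

Definition no_absentmindedness Q : Prop :=
  ~ exists y1 y2, [/\ pY Q y1, pY Q y2, prec Q y1 y2 &
      situation_of Q y1 = situation_of Q y2].

End Pentaform.

(* Main.v *)
(* If y1 precedes y2 and both belong to the same situation, then perfect recall
   applied to (y0, y1, y2) := (y1, y2, y1) yields a strict predecessor y00 of y1
   in the situation of y1, so that (y00, y1) is again such a pair. Iterating, one
   descends forever along the predecessors of y2, contradicting [Py]. *)
Require Import Defs.
From mathcomp Require Import all_boot.
From mathcomp Require Import boolp classical_sets.

Section PredecessorIteration.
Set Implicit Arguments.
Unset Strict Implicit.

Lemma app_eq (T U : Type) (f : set (T * U)) (x : T) (z : U) :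
  is_function f -> f (x, z) -> app f x = Some z.
Proof.
move=> f_fun fxz; rewrite /app; case: pselect => [e|[]]; last by exists z.
by congr Some; apply: f_fun fxz; exact: (projT2 (cid e)).
Qed.

Lemma app_None (T U : Type) (f : set (T * U)) (x : T) :
  ~ (exists z, f (x, z)) -> app f x = None.
Proof. by move=> fxN; rewrite /app; case: pselect. Qed.

Variables (I J N A : Type) (Q : set (quintuple I J N A)).

Lemma pred_iterD (k m : nat) (x y : N) :
  pred_iter Q k y = Some x -> pred_iter Q (m + k) y = pred_iter Q m x.
Proof. by rewrite /pred_iter iterD => ->. Qed.

Lemma pred_iter_out (m : nat) (z : N) :
  ~ pY Q z -> pred_iter Q m.+1 z = None.
Proof.
move=> zNY; rewrite /pred_iter iterSr /= app_None; first by elim: m => //= m ->.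
by case=> w [q Qq [qz _]]; apply: zNY; exists q.
Qed.

Lemma preceq_pred_iter (x y : N) :
  is_function (pYW Q) -> preceq Q x y -> exists m, pred_iter Q m y = Some x.
Proof.
move=> p_fun [m [s [_ <- <- sP]]]; exists m.
(* The last link of the chain is the first predecessor step from [s m.+1], so the induction shortens
   the chain at its end. *)
elim: m sP => // m IHm sP.
have [q Qq [qw qy]] := sP m (ltnSn m).
have step : pred_iter Q 1 (s m.+1) = Some (s m).
  by apply: app_eq => //; exists q => //; rewrite qw qy.
by have := pred_iterD m step; rewrite addn1 => ->; apply: IHm => l /ltnW/sP.
Qed.

Lemma prec_pred_iter (x y : N) :
  is_function (pYW Q) -> prec Q x y -> exists m, pred_iter Q m.+1 y = Some x.
Proof.
move=> p_fun [/(preceq_pred_iter p_fun)[[|m] mx] xNy]; last by exists m.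
by case: mx => yx; case: xNy.
Qed.

(** Past a value outside [pY Q] the iteration is [None] and cannot return to [pY Q]. *)
Lemma pred_iter_lt_out (k m : nat) (x y z : N) :
  pY Q x -> ~ pY Q z -> pred_iter Q k y = Some x -> pred_iter Q m y = Some z ->
  k < m.
Proof.
move=> xY zNY kx mz; rewrite ltnNge leq_eqVlt; apply/norP; split.
  by apply/eqP => mk; move: mz; rewrite mk kx => -[xz]; apply: zNY; rewrite -xz.
apply/negP => mk; move: kx.
by rewrite -(subnK mk) addnS -addSn (pred_iterD _ mz) pred_iter_out.
Qed.

End PredecessorIteration.

Theorem proposition4p6 (I J N A : Type) (Q : set (quintuple I J N A)) :
  pentaform Q -> perfect_recall Q -> no_absentmindedness Q.
Proof.
move=> pfQ recall [y1 [y2 [y1Y y2Y y12 j12]]].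
have [m _ [z mz zNY]] := Py pfQ y2Y.
(* The descent is measured by the number [m] of predecessor steps from the later node [y2] to the
   exit [z]. *)
elim/ltn_ind: m y1 y2 y1Y y2Y y12 j12 mz => m IHm y1 y2 y1Y y2Y y12 j12 mz.
have [|y00 [y00Y y001 [j001 _]]] :=
  recall y1 y2 y1 y1Y y2Y y1Y (esym j12) y12.
  by rewrite /player_of j12.
have [k ky1] := prec_pred_iter (Pwy pfQ) y12.
have km := pred_iter_lt_out y1Y zNY ky1 mz.
(* The later node is now [y1], lying [k.+1] steps below [y2] on the same path to [z], so [m - k.+1]
   steps remain. *)
apply: (IHm (m - k.+1) _ y00 y1) => //.
  by rewrite ltn_subrL (leq_trans _ km).
by rewrite -(pred_iterD _ ky1) subnK ?(ltnW km).
Qed.
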